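(* Let $q$ be any prime power and $\overline{\mathbb F}_q$ an algebraic closure of $\mathbb F_q$. Let $s,t\in\overline{\mathbb F}_q$ with $t(1+s+t)\neq0$ and let $f_{s,t}=\frac{X^3+sX+t}{X(X-1)}\in\overline{\mathbb F}_q(X)$. Then $f_{s,t}$ has no ramification point of index $2$ (i.e. no $a\in\mathbb P^1(\overline{\mathbb F}_q)$ with $e_{f_{s,t}}(a)=2$) if and only if $(s,t)=(-3,1)$.
   Context: For a rational function $f$ over a field $K$ and $a\in\mathbb P^1(K)=K\cup\{\infty\}$, the ramification index $e_f(a)$ is: $\nu_{X-a}(f(X)-f(a))$ if $a\neq\infty$, $f(a)\neq\infty$; $\nu_{X-a}(1/f(X))$ if $a\neq\infty$, $f(a)=\infty$; $\nu_X(f(1/X)-f(\infty))$ if $a=\infty$, $f(\infty)\neq\infty$; $\nu_X(1/f(1/X))$ if $a=\infty=f(\infty)$, where $\nu_{X-a}$ denotes the order of vanishing at $X=a$. Here $K=\overline{\mathbb F}_q$. *)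

(* Defs.v *)
From HB Require Import structures.
From mathcomp Require Import all_boot all_order all_algebra all_field.

Set Implicit Arguments.
Unset Strict Implicit.
Unset Printing Implicit Defensive.

Import GRing.Theory.
Local Open Scope ring_scope.

Local Notation "x %:F" := (@FracField.tofrac _ x) : ring_scope.

(* None is the point at infinity. *)
Definition P1 (K : fieldType) : Type := option K.

Section RationalFunctions.

Variable K : fieldType.

Local Notation ratfun := {fraction {poly K}}.

(* The quotient type only provides an arbitrary representative n/d of f;
   dividing by the gcd gives f in lowest terms. *)
Definition rf_num (f : ratfun) : {poly K} :=
  let n := \n_(repr f) in let d := \d_(repr f) in n %/ gcdp n d.

Definition rf_den (f : ratfun) : {poly K} :=
  let n := \n_(repr f) in let d := \d_(repr f) in d %/ gcdp n d.

Definition rf_const (c : K) : ratfun := (c%:P)%:F.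

Definition rf_inv_var (f : ratfun) : ratfun :=
  (map_poly rf_const (rf_num f)).[('X%:F)^-1] /
  (map_poly rf_const (rf_den f)).[('X%:F)^-1].

(* The order of vanishing at X = a, negative at a pole.  The order of the zero
   function is +oo, but this int-valued version returns 0 there. *)
Definition rf_ord (a : K) (f : ratfun) : int :=
  (mup a (rf_num f))%:Z - (mup a (rf_den f))%:Z.

Definition rf_eval_fin (f : ratfun) (a : K) : P1 K :=
  if (rf_den f).[a] == 0 then None else Some ((rf_num f).[a] / (rf_den f).[a]).

Definition rf_eval (f : ratfun) (a : P1 K) : P1 K :=
  match a with
  | Some a => rf_eval_fin f a
  | None => rf_eval_fin (rf_inv_var f) 0
  end.

(* Meaningful for nonconstant f only, since rf_ord is a junk value at 0. *)
Definition ram_index (f : ratfun) (a : P1 K) : int :=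
  match a, rf_eval f a with
  | Some a, Some b => rf_ord a (f - rf_const b)
  | Some a, None => rf_ord a (f^-1)
  | None, Some b => rf_ord 0 (rf_inv_var f - rf_const b)
  | None, None => rf_ord 0 ((rf_inv_var f)^-1)
  end.

Definition f_st (s t : K) : ratfun :=
  ('X^3 + s *: 'X + t%:P)%:F / ('X * ('X - 1))%:F.

End RationalFunctions.

(* Main.v *)
(** Write f = N/D with N = X^3 + sX + t and D = X(X - 1); the hypothesis on s, t
    makes N and D coprime, so the poles 0, 1 and infinity are simple.  At any
    other point a the fiber polynomial N - f(a)D is a monic cubic, and a is
    ramified iff it is a root of W = N'D - ND' = X^4 - 2X^3 - sX^2 - 2tX + t.
    Then N - f(a)D = (X - a)^2 (X - f(a) + 2a), so the index is 2 or 3, and it is 3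
    iff s = 3a^2 - 3a and t = -a^3, in which case
    W = (X - a)^2 (X^2 + (2a - 2)X - a).  If every root of W has index 3, comparing
    s and t at a and at a root c of the second factor gives a + c = ac = 1 in
    characteristic other than 3, hence (s, t) = (-3, 1); in characteristic 3,
    s = 0 and -1 is a root of W, so t = 1.  Conversely (s, t) = (-3, 1) gives
    W = (X^2 - X + 1)^2, whose roots all have index 3. *)

Require Import Defs.
From HB Require Import structures.
From mathcomp Require Import all_boot all_order all_algebra all_field.
From mathcomp Require Import ring.
Import GRing.Theory.
Local Open Scope ring_scope.

Set Implicit Arguments.
Unset Strict Implicit.
Unset Printing Implicit Defensive.

Local Notation "x %:F" := (@FracField.tofrac _ x) : ring_scope.

(** * Rational functions in lowest terms: values and orders *)

Lemma fraction_repr (R : idomainType) (f : {fraction R}) :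
  f = (\n_(repr f))%:F / (\d_(repr f))%:F.
Proof.
have dF0 : (\d_(repr f))%:F != 0 :> {fraction R}.
  by rewrite tofrac_eq0 denom_ratioP.
apply: (mulIf dF0); rewrite mulfVK //.
elim/quotW: f {dF0} => x; set y := repr _.
have hy := FracField.equivf_r x; rewrite -/y in hy.
rewrite -{1}[x]FracField.Ratio_numden; unlock FracField.tofrac.
rewrite -[LHS]FracField.pi_mul; apply/eqmodP => /=.
rewrite FracField.equivfE /FracField.mulf FracField.Ratio_numden.
by rewrite !numden_Ratio ?mulf_neq0 ?oner_neq0 ?denom_ratioP // !mulr1 hy.
Qed.

Section LowestTerms.

Variable K : fieldType.
Implicit Types (f : {fraction {poly K}}) (n d : {poly K}) (a : K).

Lemma rf_den_neq0 f : rf_den f != 0.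
Proof.
rewrite /rf_den; set n := _.1; set d := _.2.
have d0 : d != 0 by exact: denom_ratioP.
apply: contraNneq d0 => e; by rewrite -(divpK (dvdp_gcdr n d)) e mul0r.
Qed.

Lemma coprimep_rf f : coprimep (rf_num f) (rf_den f).
Proof. by apply: coprimep_div_gcd; rewrite denom_ratioP orbT. Qed.

Lemma rf_numK f : f = (rf_num f)%:F / (rf_den f)%:F.
Proof.
rewrite {1}[f]fraction_repr /rf_num /rf_den; set n := _.1; set d := _.2.
have d0 : d != 0 by exact: denom_ratioP.
have g0 : gcdp n d != 0 by rewrite gcdp_eq0 negb_and d0 orbT.
rewrite -[X in X%:F / _](divpK (dvdp_gcdl n d)).
rewrite -[X in _ / X%:F = _](divpK (dvdp_gcdr n d)) !tofracM.
by rewrite -mulf_div divff ?mulr1 // tofrac_eq0.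
Qed.

Lemma rf_cross n d : d != 0 ->
  rf_num (n%:F / d%:F) * d = n * rf_den (n%:F / d%:F).
Proof.
move=> d0; set f := _ / _; apply/eqP; rewrite -tofrac_eq !tofracM -eqr_div.
- by rewrite -rf_numK.
- by rewrite tofrac_eq0 rf_den_neq0.
- by rewrite tofrac_eq0.
Qed.

(** Two coprime pairs with equal cross products have denominators dividing each other, by Gauss. The
    scalar [c] remains because the representative is arbitrary; it cancels in values and orders. *)
Lemma rf_lowest_terms n d : d != 0 -> coprimep n d ->
  exists2 c, c != 0 &
    rf_num (n%:F / d%:F) = c *: n /\ rf_den (n%:F / d%:F) = c *: d.
Proof.
move=> d0 cop; have := rf_cross n d0; set f := _ / _ => e.
have /eqpf_eq[c c0 ec] : rf_den f %= d.
  apply/andP; split.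
    have := coprimep_rf f; rewrite coprimep_sym => /Gauss_dvdpr <-.
    by rewrite e dvdp_mull.
  by move: cop; rewrite coprimep_sym => /Gauss_dvdpr <-; rewrite -e dvdp_mull.
exists c => //; split => //; apply: (mulIf d0).
by rewrite e ec -scalerAl scalerAr.
Qed.

Lemma rf_eval_fin_frac n d a : d != 0 -> coprimep n d ->
  rf_eval_fin (n%:F / d%:F) a =
  if d.[a] == 0 then None else Some (n.[a] / d.[a]).
Proof.
move=> d0 /(rf_lowest_terms d0)[c c0 [en ed]].
rewrite /rf_eval_fin en ed !hornerZ mulf_eq0 (negPf c0) /=.
by rewrite -mulf_div divff // mul1r.
Qed.

(** Multiplicities add over the two sides of [rf_cross], so common factors cancel in the
    difference. *)
Lemma rf_ord_frac n d a : n != 0 -> d != 0 ->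
  rf_ord a (n%:F / d%:F) = (mup a n)%:Z - (mup a d)%:Z.
Proof.
move=> n0 d0; have e := rf_cross n d0; have den0 := rf_den_neq0 (n%:F / d%:F).
have num0 : rf_num (n%:F / d%:F) != 0.
  by have := mulf_neq0 n0 den0; rewrite -e mulf_eq0 negb_or => /andP[].
have := congr1 (mup a) e; rewrite !mupM // => {}e.
by apply/eqP; rewrite /rf_ord subr_eq addrAC eq_sym subr_eq -!PoszD e.
Qed.

End LowestTerms.

(** Derives an equation from a known one with an explicit cofactor [k], leaving an identity for
    [ring]. *)
Lemma eq_lincomb (R : comNzRingType) (k u v x y : R) :
  u = v -> x - y = k * (u - v) -> x = y.
Proof. by move=> ->; rewrite subrr mulr0; apply: subr0_eq. Qed.

Lemma eq_lincomb2 (R : comNzRingType) (k1 k2 u1 v1 u2 v2 x y : R) :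
  u1 = v1 -> u2 = v2 -> x - y = k1 * (u1 - v1) + k2 * (u2 - v2) -> x = y.
Proof. by move=> -> ->; rewrite !subrr !mulr0 addr0; apply: subr0_eq. Qed.

(* N'D - ND' at a, where f_st s t = N/D. *)
Local Notation wronskian s t a :=
  (a ^+ 4 - 2 * a ^+ 3 - s * a ^+ 2 - 2 * t * a + t).

(** * Ramification of [f_st s t] at its poles and at the other points *)

Section CubicMap.

Variables (K : fieldType) (s t : K).
Hypothesis hst : t * (1 + s + t) != 0.

Local Notation N := ('X^3 + s *: 'X + t%:P : {poly K}).
Local Notation D := ('X * ('X - 1) : {poly K}).

Lemma f_st_hornerN (a : K) : N.[a] = a ^+ 3 + s * a + t.
Proof. by rewrite !hornerE. Qed.

Lemma f_st_hornerD (a : K) : D.[a] = a * (a - 1).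
Proof. by rewrite !hornerE. Qed.

Lemma f_st_den_neq0 : D != 0.
Proof. by rewrite mulf_neq0 ?polyX_eq0 // -polyC1 polyXsubC_eq0. Qed.

(** The values of [N] at 0 and 1 are [t] and [1 + s + t], the two factors in [hst]. *)
Lemma f_st_num_pole (a : K) : D.[a] = 0 -> N.[a] != 0.
Proof.
move: hst; rewrite mulf_eq0 negb_or => /andP[t0 t1].
rewrite f_st_hornerN f_st_hornerD => /eqP.
rewrite mulf_eq0 subr_eq0 => /orP[] /eqP ->.
  by rewrite expr0n /= mulr0 !add0r.
by rewrite expr1n mulr1.
Qed.

Lemma f_st_num_neq0 : N != 0.
Proof.
apply: contraTneq (@f_st_num_pole 0 _) => [->|]; rewrite ?horner0 ?eqxx //.
by rewrite f_st_hornerD mul0r.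
Qed.

Lemma f_st_coprime : coprimep N D.
Proof.
have cop c : D.[c] = 0 -> coprimep N ('X - c%:P).
  by move=> Dc; rewrite coprimep_XsubC f_st_num_pole.
rewrite coprimepMr; apply/andP; split.
  by rewrite -[X in coprimep _ X]subr0; apply: cop; rewrite f_st_hornerD mul0r.
by apply: cop; rewrite f_st_hornerD subrr mulr0.
Qed.

Lemma map_f_st_numE (L : fieldType) (g : {rmorphism K -> L}) (c : K) (x : L) :
  (map_poly g (c *: N)).[x] = g c * (x ^+ 3 + g s * x + g t).
Proof.
rewrite map_polyZ hornerZ !rmorphD /= map_polyXn map_polyZ map_polyX map_polyC.
by rewrite !hornerE.
Qed.

Lemma map_f_st_denE (L : fieldType) (g : {rmorphism K -> L}) (c : K) (x : L) :
  (map_poly g (c *: D)).[x] = g c * (x * (x - 1)).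
Proof.
rewrite map_polyZ hornerZ rmorphM rmorphB rmorph1 /= map_polyX.
by rewrite !hornerE.
Qed.

Lemma cubic_inv_var (L : fieldType) (c u v x : L) : c != 0 -> x != 0 -> 1 - x != 0 ->
  c * (x^-1 ^+ 3 + u * x^-1 + v) / (c * (x^-1 * (x^-1 - 1))) =
  (1 + u * x ^+ 2 + v * x ^+ 3) / (x * (1 - x)).
Proof. by move=> c0 x0 x1; field; rewrite c0 x0 x1. Qed.

Lemma rf_inv_var_f_st :
  rf_inv_var (f_st s t) =
  (1 + s *: 'X^2 + t *: 'X^3)%:F / ('X * (1 - 'X))%:F.
Proof.
have [c c0 [en ed]] := rf_lowest_terms f_st_den_neq0 f_st_coprime.
rewrite /rf_inv_var /f_st {}en {}ed.
(* As a composite of morphisms, [rf_const] fits the morphism [g] of the two evaluation lemmas. *)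
have -> : map_poly (@rf_const K) = map_poly (@FracField.tofrac {poly K} \o polyC) by [].
rewrite map_f_st_numE map_f_st_denE cubic_inv_var /=.
- by rewrite -!mul_polyC !tofracD (tofracM 'X) (tofracM s%:P) (tofracM t%:P) !tofracXn
    tofracB tofrac1.
- by rewrite tofrac_eq0 polyC_eq0.
- by rewrite tofrac_eq0 polyX_eq0.
- by rewrite -tofrac1 -tofracB tofrac_eq0 -opprB oppr_eq0 -polyC1 polyXsubC_eq0.
Qed.

Lemma mup_f_st_den (a : K) : D.[a] = 0 -> mup a D = 1%N.
Proof.
rewrite f_st_hornerD => /eqP; rewrite mulf_eq0 subr_eq0 => /orP[] /eqP ->.
  rewrite mupMl; last by rewrite /root !hornerE oppr_eq0 oner_eq0.
  by have := mup_XsubCX 1 (0 : K) 0; rewrite expr1 subr0 eqxx.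
rewrite mupMr; last by rewrite /root hornerX oner_eq0.
by have := mup_XsubCX 1 (1 : K) 1; rewrite expr1 eqxx.
Qed.

Lemma ram_index_f_st_pole (a : K) : D.[a] = 0 -> ram_index (f_st s t) (Some a) = 1.
Proof.
move=> Da; rewrite /ram_index /= /f_st rf_eval_fin_frac ?f_st_den_neq0 ?f_st_coprime //.
rewrite Da eqxx invf_div rf_ord_frac ?f_st_den_neq0 ?f_st_num_neq0 //.
by rewrite mup_f_st_den // mupNroot // /root f_st_num_pole.
Qed.

(** The inverse of [f(1/X)] is [X(1 - X)/n] with [n(0) = 1], so it has a simple zero at 0. *)
Lemma ram_index_f_st_infty : ram_index (f_st s t) None = 1.
Proof.
rewrite /ram_index /= rf_inv_var_f_st; set n := 1 + _ + _; set d := 'X * _.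
have n0 : n.[0] = 1 by rewrite /n !hornerE /=; ring.
have nn0 : n != 0 by apply: contra_eqN n0 => /eqP ->; rewrite horner0 eq_sym oner_eq0.
have x1 : 1 - 'X != 0 :> {poly K} by rewrite -opprB oppr_eq0 -polyC1 polyXsubC_eq0.
have d0 : d != 0 by rewrite mulf_neq0 ?polyX_eq0.
have n1 : n.[1] = 1 + s + t by rewrite /n !hornerE /=; ring.
have cop : coprimep n d.
  rewrite coprimepMr -opprB -scaleN1r coprimepZr ?oppr_eq0 ?oner_eq0 //.
  rewrite -[X in coprimep _ X && _]subr0 -polyC1 !coprimep_XsubC /root n0 n1 oner_eq0.
  by move: hst; rewrite mulf_eq0 negb_or => /andP[].
rewrite rf_eval_fin_frac // /d hornerM hornerX mul0r eqxx -/d invf_div rf_ord_frac //.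
rewrite [mup 0 n]mupNroot ?/root ?n0 ?oner_eq0 // mupMl; last first.
  by rewrite /root !hornerE subr0 oner_eq0.
by have := mup_XsubCX 1 (0 : K) 0; rewrite expr1 subr0 eqxx => ->.
Qed.

Lemma f_st_fiber_neq0 (b : K) : N - b *: D != 0.
Proof.
have D0 : D.[0] = 0 by rewrite f_st_hornerD mul0r.
apply: contraTneq (f_st_num_pole D0) => e; rewrite negbK.
have := congr1 (horner^~ 0) e.
by rewrite /= hornerD hornerN hornerZ D0 mulr0 subr0 horner0 => /eqP.
Qed.

Lemma ram_index_f_st_fin (a : K) : D.[a] != 0 ->
  ram_index (f_st s t) (Some a) = mup a (N - (N.[a] / D.[a]) *: D).
Proof.
move=> Da; rewrite /ram_index /= /f_st rf_eval_fin_frac ?f_st_den_neq0 ?f_st_coprime //.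
rewrite (negPf Da); set b := N.[a] / D.[a].
have -> : N%:F / D%:F - rf_const b = (N - b *: D)%:F / D%:F.
  rewrite -mul_polyC tofracB (tofracM b%:P) mulrBl mulfK // tofrac_eq0.
  exact: f_st_den_neq0.
rewrite rf_ord_frac ?f_st_fiber_neq0 ?f_st_den_neq0 //.
by rewrite [mup a D]mupNroot // subr0.
Qed.

(** As [N(a) = b D(a)], the wronskian is [D(a) (N'(a) - b D'(a))], so [a] is a double root of
    [N - b D]. The formulas compare coefficients with [(X - a)^2 (X - (b - 2a))], whose last root is
    fixed by the root sum [b]. *)
Lemma f_st_fiber_coefs (a : K) : D.[a] != 0 -> wronskian s t a = 0 ->
  let b := N.[a] / D.[a] in
  s = 2 * a * b - 3 * a ^+ 2 - b /\ t = 2 * a ^+ 3 - a ^+ 2 * b.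
Proof.
move=> Da wa b.
have eb : b * (a * (a - 1)) = a ^+ 3 + s * a + t.
  by rewrite -f_st_hornerN -f_st_hornerD divfK.
have es : s = 2 * a * b - 3 * a ^+ 2 - b.
  apply: (mulIf Da); rewrite f_st_hornerD.
  by apply: (eq_lincomb2 (k1 := 1) (k2 := 1 - 2 * a) wa eb); ring.
by split=> //; apply: (eq_lincomb2 (k1 := -1) (k2 := - a) eb es); ring.
Qed.

Lemma f_st_fiberE (a : K) : D.[a] != 0 -> wronskian s t a = 0 ->
  let b := N.[a] / D.[a] in
  N - b *: D = ('X - a%:P) ^+ 2 * ('X - (b - 2 * a)%:P).
Proof.
move=> Da wa b; have [es et] := f_st_fiber_coefs Da wa; rewrite -/b in es et.
have -> : N = 'X^3 + (2 * a * b - 3 * a ^+ 2 - b) *: 'X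
              + (2 * a ^+ 3 - a ^+ 2 * b)%:P by rewrite -es -et.
rewrite -!mul_polyC !(rmorphB, rmorphM, rmorphXn, rmorph_nat) /=.
ring.
Qed.

Lemma f_st_fiber_double (a : K) : D.[a] != 0 ->
  mup a (N - (N.[a] / D.[a]) *: D) = 2%N -> wronskian s t a = 0.
Proof.
set b := N.[a] / D.[a] => Da m2.
have := f_st_fiber_neq0 b; set P := N - _ => P0.
have : ('X - a%:P) ^+ 2 %| P by rewrite -mup_geq // m2.
case/dvdpP => Q eP.
(* A double root also kills the derivative; eliminating [b] with [eb] turns this into the
   wronskian. *)
have dP : (P^`()).[a] = 0.
  by rewrite eP !derivCE !hornerE /=; ring.
have eb : b * (a * (a - 1)) = a ^+ 3 + s * a + t.
  by rewrite -f_st_hornerN -f_st_hornerD divfK.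
have : 3 * a ^+ 2 + s - b * (2 * a - 1) = 0.
  by rewrite -[RHS]dP /P !derivCE !hornerE /=; ring.
by move=> e; apply: (eq_lincomb2 (k1 := a * (a - 1)) (k2 := 2 * a - 1) e eb); ring.
Qed.

(* By f_st_fiberE, e(a) = 2 unless the third root b - 2a of the fiber is a. *)
Lemma f_st_triple (a : K) : D.[a] != 0 -> wronskian s t a = 0 ->
  ram_index (f_st s t) (Some a) != 2 ->
  s = 3 * a ^+ 2 - 3 * a /\ t = - a ^+ 3.
Proof.
move=> Da wa; rewrite ram_index_f_st_fin // f_st_fiberE //.
have [es et] := f_st_fiber_coefs Da wa.
set b := N.[a] / D.[a] in es et * => e2.
have eb : b = 3 * a.
  apply/eqP; apply: contraR e2 => nb; rewrite mupMl ?mup_XsubCX ?eqxx //.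
  rewrite root_XsubC; apply: contra nb => /eqP ea.
  by apply/eqP; apply: (eq_lincomb (k := -1) ea); ring.
by split; [rewrite es eb; ring | rewrite et eb; ring].
Qed.

End CubicMap.

Unset Implicit Arguments.

Theorem theorem6p4 (q p k : nat) (hp : prime p) (hk : (0 < k)%N)
    (hq : q = (p ^ k)%N) (F : finFieldType) (hF : #|F| = q)
    (K : closedFieldType) (iota : {rmorphism F -> K})
    (hiota : integralRange iota)
    (s t : K) (hst : t * (1 + s + t) != 0) :
  ~ (exists a : P1 K, ram_index (f_st s t) a = 2%:Z) <->
  (s, t) = (- 3%:R, 1).
Proof.
(* The wronskian is [t] at 0 and [-(1 + s + t)] at 1, so its roots are never poles. *)
have pole a : a * (a - 1) = 0 -> wronskian s t a != 0.
  move: hst; rewrite mulf_eq0 negb_or => /andP[t0 t1] /eqP.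
  rewrite mulf_eq0 subr_eq0 => /orP[] /eqP ->.
    by rewrite !expr0n /= !mulr0 !subr0 add0r.
  rewrite -oppr_eq0; congr (_ != 0): t1; ring.
split=> [noram | [es et] [[a|]]].
- have triple a : wronskian s t a = 0 ->
      s = 3 * a ^+ 2 - 3 * a /\ t = - a ^+ 3.
    move=> wa; have Da : ('X * ('X - 1) : {poly K}).[a] != 0.
      by rewrite f_st_hornerD; apply: contra_eqN wa => /eqP/pole.
    by apply: f_st_triple => //; apply/eqP => e; apply: noram; exists (Some a).
  have [a wa] : exists a, wronskian s t a = 0.
    (* The list holds the coefficients, constant term first, of [a^4 = 2a^3 + s a^2 + 2t a - t]. *)
    have [a] := @solve_monicpoly K 4 (nth 0 [:: - t; 2 * t; s; 2]) isT.
    rewrite !big_ord_recl big_ord0 /= => ea.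
    by exists a; rewrite ea /bump /=; ring.
  have [es et] := triple a wa.
  have [c qc] : exists c, c ^+ 2 + (2 * a - 2) * c - a = 0.
    have [c] := @solve_monicpoly K 2 (nth 0 [:: a; 2 - 2 * a]) isT.
    rewrite !big_ord_recl big_ord0 /= => ec.
    by exists c; rewrite ec /bump /=; ring.
  have [es' et'] : s = 3 * c ^+ 2 - 3 * c /\ t = - c ^+ 3.
    apply: triple; rewrite es et.
    suff -> : wronskian (3 * a ^+ 2 - 3 * a) (- a ^+ 3) c =
              (c - a) ^+ 2 * (c ^+ 2 + (2 * a - 2) * c - a).
      by rewrite qc mulr0.
    ring.
  have a01 : a * (a - 1) != 0 by apply: contra_eqN wa => /eqP/pole.
  (* In characteristic 3, [s = 0] and the wronskian at -1 is [3(1 + t) = 0]. *)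
  have [char3|n3] := eqVneq (3 : K) 0.
    have s0 : s = 0 by rewrite es char3 !mul0r subrr.
    have [_ ->] : s = 3 * (-1) ^+ 2 - 3 * (-1) /\ t = - (-1) ^+ 3.
      by apply: triple; rewrite s0; apply: (eq_lincomb (k := 1 + t) char3); ring.
    by rewrite s0 char3 oppr0; congr pair; ring.
  (* [c = a] would give [3a(a - 1) = 0], making [a] a pole. *)
  have nca : c - a != 0.
    apply: contra_eqN qc => /eqP/subr0_eq ->.
    have -> : a ^+ 2 + (2 * a - 2) * a - a = 3 * (a * (a - 1)) by ring.
    by rewrite mulf_neq0.
  (* The two formulas for [s] give [3(c - a)(c + a - 1) = 0]. *)
  have sum1 : c = 1 - a.
    apply: (mulIf nca); apply: (mulfI n3).
    have : 3 * c ^+ 2 - 3 * c = 3 * a ^+ 2 - 3 * a by rewrite -es.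
    by move=> e; apply: (eq_lincomb (k := 1) e); ring.
  (* Dividing [c^3 = a^3] by [c - a] gives [(a + c)^2 = ac], and [a + c = 1]. *)
  have prod1 : a * (1 - a) = 1.
    have e : c ^+ 3 = a ^+ 3 by apply: oppr_inj; rewrite -et.
    apply: (mulIf nca); rewrite sum1 in e *.
    by apply: (eq_lincomb (k := -1) e); ring.
  congr pair; first by rewrite es; apply: (eq_lincomb (k := - 3) prod1); ring.
  by rewrite et; apply: (eq_lincomb (k := a + 1) prod1); ring.
- have [Da|Da] := eqVneq ('X * ('X - 1) : {poly K}).[a] 0.
    by rewrite ram_index_f_st_pole.
  rewrite ram_index_f_st_fin // => -[m2].
  have wa := f_st_fiber_double hst Da m2.
  have [es' et'] := f_st_fiber_coefs Da wa.
  move: m2; rewrite f_st_fiberE //; set b := _ / _ in es' et' *; clearbody b.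
  rewrite es in wa; rewrite et in wa et'.
  (* At [(-3, 1)] the wronskian is [(a^2 - a + 1)^2]. *)
  have qa : a ^+ 2 - a + 1 = 0.
    apply/eqP; rewrite -sqrf_eq0; apply/eqP; apply: (eq_lincomb (k := 1) wa); ring.
  (* [et'] reads [1 = -a^2 (b - 2a)], while [qa] gives [a^3 = -1]; the third root is thus [a] and
     the index is 3. *)
  have -> : b - 2 * a = a.
    by apply: (eq_lincomb2 (k1 := - a) (k2 := (a + 1) * (b - 2 * a)) et' qa); ring.
  by rewrite -exprSr mup_XsubCX eqxx.
- by rewrite ram_index_f_st_infty.
Qed.
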